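(* For every $\epsilon>0$ there exists an infinite graph $G$ with exponential growth (with respect to a root $x_0$) and uniformly bounded degree such that, with one unit of demand between every pair of nodes of $G_n=B(x_0,n)$ routed along shortest paths in $G_n$, for all $n$ sufficiently large and every node $v\in G_n$, $$T_n(v)\ \le\ N^{1+\epsilon},$$ where $N=|G_n|$.
   Context: Graphs are connected and every edge has length $1$; $d$ is the resulting graph distance. A node $x_0$ of $G$ is fixed as the root, and $G_n=B(x_0,n)$ is the subgraph induced on the nodes $y$ with $d(x_0,y)\le n$; $|G_n|$ is its number of nodes. $G$ has exponential growth if there exist $n_0$ and $\lambda>1$ such that $|G_n|\ge\lambda^n$ for all $n\ge n_0$. Uniformly bounded degree means $\sup_{v\in G}\deg(v)<\infty$. There is one unit of demand between each unordered pair of distinct nodes of $G_n$. Each unit of demand is routed along shortest (geodesic) paths of $G_n$ between its two endpoints. $T_n(v)$ is the total flow in $G_n$ routed through the node $v$ (demand having $v$ as an endpoint is counted as passing through $v$). *)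

(* Defs.v *)
From HB Require Import structures.
From mathcomp Require Import all_boot all_order all_algebra finmap.
From mathcomp Require Import all_classical all_reals all_analysis.

Set Implicit Arguments.
Unset Strict Implicit.
Unset Printing Implicit Defensive.

Import Order.TTheory GRing.Theory Num.Theory.

Local Open Scope classical_set_scope.
Local Open Scope ring_scope.

(* As in path.v, a walk from x is given by x and the sequence p of the nodes
   visited after x; its length (number of edges) is size p. *)
Definition walk (T : eqType) (e : rel T) (x y : T) (p : seq T) : bool :=
  path e x p && (last x p == y).

Definition connected_graph (T : eqType) (e : rel T) : Prop :=
  forall x y : T, exists p : seq T, walk e x y p.

Definition walk_length (T : eqType) (e : rel T) (x y : T) : pred nat :=
  fun k => `[< exists2 p : seq T, walk e x y p & size p = k >].

(* The value is the dummy 0 when no walk joins x to y; this never happens in a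
   connected graph, nor in a ball around the root of a connected graph. *)
Definition gdist (T : eqType) (e : rel T) (x y : T) : nat :=
  if pselect (exists k, walk_length e x y k) is left h then ex_minn h else 0%N.

Definition geodesic (T : eqType) (e : rel T) (x y : T) (p : seq T) : bool :=
  walk e x y p && (size p == gdist e x y).

Record graph := Graph {
  node :> choiceType;
  adj : rel node;
  adj_sym : symmetric adj;
  adj_irr : irreflexive adj
}.

Definition bounded_degree (G : graph) : Prop :=
  exists D : nat, forall v : G, ([set u | adj v u] #<= `I_D)%card.

(* fset_set is the dummy fset0 on infinite sets; the balls of a graph of bounded
   degree are finite. *)
Definition gball (G : graph) (x0 : G) (n : nat) : {fset G} :=
  fset_set [set y : G | (gdist (@adj G) x0 y <= n)%N].

Definition induced_adj (G : graph) (B : {fset G}) : rel B :=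
  fun u v => adj (val u) (val v).

Definition exponential_growth (R : realType) (G : graph) (x0 : G) : Prop :=
  exists (n0 : nat) (lambda : R), 1 < lambda /\
    forall n : nat, (n0 <= n)%N -> lambda ^+ n <= #|` gball x0 n|%:R.

Section Flow.
Variables (R : realType) (T : finType) (e : rel T).

(* Node sequences of the geodesics between the two elements of A. Each geodesic
   is listed twice, once in each direction; the flows on both lists add up. *)
Definition pair_geodesics (A : {set T}) : set (seq T) :=
  [set s | exists x y p,
     [/\ A = [set x; y]%SET, s = x :: p & geodesic e x y p]].

(* w A s is the part of the unit of demand between the two elements of A that
   is routed along s; a demand may be split among several geodesics. *)
Definition geodesic_routing (w : {set T} -> seq T -> R) : Prop :=
  forall A : {set T}, #|A| = 2%N ->
    (forall s, pair_geodesics A s -> 0 <= w A s) /\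
    \sum_(s \in pair_geodesics A) w A s = 1.

Definition traffic (w : {set T} -> seq T -> R) (v : T) : R :=
  \sum_(A : {set T} | #|A| == 2%N)
    \sum_(s \in [set s | pair_geodesics A s /\ v \in s]) w A s.

End Flow.

(* Main.v *)
Require Import Defs.
From HB Require Import structures.
From mathcomp Require Import all_boot all_order all_algebra finmap.
From mathcomp Require Import all_classical all_reals all_analysis.

Set Implicit Arguments.
Unset Strict Implicit.
Unset Printing Implicit Defensive.

Import Order.TTheory GRing.Theory Num.Theory.

Local Open Scope classical_set_scope.
Local Open Scope ring_scope.

(** Take for [G] the words over an alphabet of [k] letters. A word [u] is joined to
    each [rcons u a], which is the [k]-ary tree, and to each
    [rcons (behead u) a], which adds the edges of a de Bruijn graph in every
    level. The root is the empty word. The distance from the root to a word is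
    its length, so the ball of radius [n] consists of the words of length at
    most [n] and has [N >= k ^ n] nodes.

    The shift edges make the diameter of this ball at most [n], instead of the
    [2 * n] of a tree: writing the letters of a word [w] one after the other at
    the end of [u], and erasing letters at the front so as not to exceed the
    length of [w], leads from [u] to [w] (lemma [word_walk]).

    The degree is at most [3 * k + 1]. A geodesic through [v] splits at [v] into
    two walks that start from [v] and have total length at most [n]. There are
    at most [(n + 1) * (3 * k + 2) ^ n] pairs of such walks, where the additional
    choice at each step is to stay in place. Whatever the geodesic routing, the
    traffic through [v] is at most the number of pairs of nodes joined by a
    geodesic through [v] (lemma [traffic_le]), so it is at most [(8 * k) ^ n].
    As [k ^ n] is nearly the largest growth that the degree permits, this is
    already [N ^ (1 + o(1))] when [k] tends to infinity: it is at most
    [N ^ (1 + eps)] as soon as [k ^ eps >= 8] (lemma [moves_count_le]). *)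

(** * Walks and distances *)

Lemma gdist_le (T : eqType) (e : rel T) (x y : T) (p : seq T) :
  walk e x y p -> (gdist e x y <= size p)%N.
Proof.
move=> xyp; rewrite /gdist; case: pselect => [h|//].
case: ex_minnP => m _; apply; apply/asboolP; exists p => //.
Qed.

Lemma gdist_ge (T : eqType) (e : rel T) (x y : T) (p : seq T) (m : nat) :
  walk e x y p -> (forall q, walk e x y q -> (m <= size q)%N) ->
  (m <= gdist e x y)%N.
Proof.
move=> xyp minm; rewrite /gdist; case: pselect => [h|[]].
  by case: ex_minnP => k /asboolP[q xyq <-] _; exact: minm.
by exists (size p); apply/asboolP; exists p.
Qed.

Lemma finite_bounded_seq (T : finType) (n : nat) :
  finite_set [set s : seq T | (size s <= n)%N].
Proof.
apply: (@sub_finite_set _ _ ((@bseqval n T) @` [set: {bseq n of T}])).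
  by move=> s /= sn; exists (Bseq sn).
by apply: finite_image; exact: finite_finset.
Qed.

Lemma rev_walk (T : eqType) (e : rel T) (x y : T) (p : seq T) : symmetric e ->
  walk e x y p -> exists2 q, walk e y x q & size q = size p.
Proof.
move=> e_sym /andP[xp /eqP <-]; exists (rev (belast x p)).
  apply/andP; split; first by rewrite rev_path (eq_path (e' := e)).
  by case: p {xp} => //= y' p; rewrite rev_cons last_rcons.
by rewrite size_rev size_belast.
Qed.

(** * Traffic in a finite graph of small degree and diameter *)

Section Traffic.
Variables (T : finType) (e : rel T) (D : nat).
Hypothesis e_sym : symmetric e.
Hypothesis e_deg : forall x, (#|e x| <= D)%N.

(** The default value of [nth] makes a walker without an [i]-th neighbour stay in
    place, as does the move [0]; this allows padding a list of moves to a
    prescribed length. *)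
Definition move_to (x : T) (i : 'I_D.+1) : T := nth x (x :: enum (e x)) i.

Definition endpoint (x : T) (ms : seq 'I_D.+1) : T := foldl move_to x ms.

Lemma endpoint_path (x : T) (p : seq T) : path e x p ->
  exists2 ms, size ms = size p & endpoint x ms = last x p.
Proof.
elim: p x => [|y p IHp] x /=; first by exists [::].
case/andP=> exy /IHp[ms msp msE].
exists (inord (index y (enum (e x))).+1 :: ms); rewrite /= ?msp //.
have yin : y \in enum (e x) by rewrite mem_enum.
rewrite -msE /endpoint /=; congr foldl; rewrite /move_to inordK /= ?nth_index //.
by rewrite ltnS (leq_trans _ (e_deg x)) // cardE index_mem.
Qed.

Lemma endpoint_stay (x : T) (m : nat) : endpoint x (nseq m ord0) = x.
Proof. by elim: m. Qed.

Variable n : nat.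

Definition pair_of (v : T) (c : 'I_n.+1 * n.-tuple 'I_D.+1) : {set T} :=
  [set endpoint v (take c.1 c.2); endpoint v (drop c.1 c.2)]%SET.

(** A geodesic through [v], of length at most [n], splits at [v]. Reversing its
    first part gives two lists of moves from [v]; padding the second one makes
    their concatenation an [n]-tuple, and the length of the first one tells where
    to cut it. Hence [pair_of v] takes as value every pair that has a geodesic
    through [v]. *)
Lemma card_pairs_through (v : T) :
  (forall x y, gdist e x y <= n)%N ->
  (#|[set A : {set T} | `[< exists2 s, pair_geodesics e A s & v \in s >]]%SET|
    <= n.+1 * D.+1 ^ n)%N.
Proof.
move=> diam; have -> : (n.+1 * D.+1 ^ n = #|[set: 'I_n.+1 * n.-tuple 'I_D.+1]%SET|)%N.
  by rewrite cardsT card_prod card_tuple !card_ord.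
apply: leq_trans (leq_imset_card (pair_of v) _); apply/subset_leq_card.
apply/fintype.subsetP=> A; rewrite inE => /asboolP[_ [x [y [p [-> -> /andP[+ /eqP sp]]]]]].
move: sp (diam x y) => <- + /andP[+ /eqP +] => + + + vin.
case/splitPl: vin => p1 p2 p1v.
rewrite cat_path last_cat p1v size_cat => pn /andP[xp1 vp2] p2y.
have [|q /andP[vq /eqP qx] qp1] := @rev_walk _ e x v p1 e_sym.
  by rewrite /walk xp1 p1v eqxx.
have [ms1 s1 e1] := endpoint_path vq; have [ms2 s2 e2] := endpoint_path vp2.
have i_lt : (size ms1 < n.+1)%N by rewrite s1 qp1 ltnS (leq_trans _ pn) // leq_addr.
have ms_size : size (ms1 ++ ms2 ++ nseq (n - (size p1 + size p2)) ord0) == n.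
  by rewrite !size_cat size_nseq s1 s2 qp1 addnA subnKC.
apply/imsetP; exists (Ordinal i_lt, Tuple ms_size); rewrite ?inE //= /pair_of /=.
rewrite take_size_cat // drop_size_cat // /endpoint foldl_cat -/(endpoint _ _) e1.
by rewrite -!/(endpoint _ _) e2 endpoint_stay qx p2y.
Qed.

(** At most the whole unit of demand of a pair passes through [v], and none of it
    unless some geodesic of the pair contains [v]. *)
Lemma traffic_le (R : realType) (w : {set T} -> seq T -> R) (v : T) :
  (forall x y, gdist e x y <= n)%N -> geodesic_routing e w ->
  traffic e w v <= (n.+1 * D.+1 ^ n)%:R.
Proof.
move=> diam rw; set B := [set A : {set T} |
  `[< exists2 s, pair_geodesics e A s & v \in s >]]%SET.
apply: (@le_trans _ _ (\sum_(A in B) 1)); last first.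
  by rewrite sumr_const ler_nat card_pairs_through.
rewrite /traffic big_mkcond [leRHS]big_mkcond /=; apply: ler_sum => A _.
case: ifPn => [/eqP /rw[w0 w1]|_]; last by case: ifP.
rewrite inE; case: asboolP => [_|noA]; last first.
  rewrite fsbig1 // => s [As vs]; case: noA; by exists s.
(* Sums over infinite sets of indices would not be monotone, since they may take
   the dummy value 0; geodesics between two given nodes are finitely many. *)
have finA : finite_set (pair_geodesics e A).
  apply: sub_finite_set (finite_bounded_seq T n.+1) => _ [x [y [p [_ -> xyp]]]] /=.
  by case/andP: xyp => _ /eqP ->; rewrite ltnS.
have finAv : finite_set [set s | pair_geodesics e A s /\ v \in s].
  by apply: sub_finite_set finA => s [].
rewrite -w1 -lee_fin -!fsumEFin //.
apply: lee_fsum_nneg_subset => // s.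
  by rewrite !inE => -[].
by rewrite inE => /andP[_ /set_mem As]; rewrite lee_fin w0.
Qed.

End Traffic.

(** * The tree of words with shift edges *)

Section Words.
Variable A : finType.

Definition append_or_shift (u v : seq A) : bool :=
  [exists a, (v == rcons u a) || (v == rcons (behead u) a)].

Definition word_adj : rel (seq A) :=
  fun u v => (u != v) && (append_or_shift u v || append_or_shift v u).

Lemma word_adj_sym : symmetric word_adj.
Proof. by move=> u v; rewrite /word_adj eq_sym orbC. Qed.

Lemma word_adj_irr : irreflexive word_adj.
Proof. by move=> u; rewrite /word_adj eqxx. Qed.

Definition word_graph : graph := Graph word_adj_sym word_adj_irr.

(** The four parts are the parent of [u], its children, the shifts of [u], and the
    words of which [u] is a shift. *)
Definition word_nbrs (u : seq A) : seq (seq A) :=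
  take (size u).-1 u ::
    [seq rcons u a | a : A] ++ [seq rcons (behead u) a | a : A] ++
    [seq a :: take (size u).-1 u | a : A].

Lemma size_word_nbrs u : size (word_nbrs u) = (3 * #|A|).+1.
Proof. by rewrite /= !size_cat !size_image !mulSn addn0. Qed.

Lemma word_adj_nbrs u v : word_adj u v -> v \in word_nbrs u.
Proof.
have take_pred (w : seq A) a : take (size (rcons w a)).-1 (rcons w a) = w.
  by rewrite size_rcons -cats1 take_size_cat.
rewrite /word_nbrs inE !mem_cat => /andP[_ /orP[]/existsP[a /orP[]/eqP ->]].
- by rewrite (fintype.image_f (fun a => rcons u a)) ?orbT.
- by rewrite (fintype.image_f (fun a => rcons (behead u) a)) ?orbT.
- by rewrite take_pred eqxx.
- rewrite take_pred; case: v => [|c v]; first by rewrite eqxx.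
  by rewrite (fintype.image_f (fun a => a :: v)) ?orbT.
Qed.

Lemma word_degree (B : {fset word_graph}) (x : B) :
  (#|induced_adj x| <= (3 * #|A|).+1)%N.
Proof.
rewrite cardE -(size_map val) -(size_word_nbrs (val x)).
apply: uniq_leq_size; first by rewrite map_inj_uniq ?enum_uniq //; exact: val_inj.
by move=> _ /mapP[y + ->]; rewrite mem_enum => /word_adj_nbrs.
Qed.

Lemma word_bounded_degree : bounded_degree word_graph.
Proof.
exists (3 * #|A|).+1 => u.
apply: card_le_trans (card_image_le (nth u (word_nbrs u)) _).
apply: subset_card_le => v /word_adj_nbrs vu; exists (index v (word_nbrs u)).
  by move: vu; rewrite -index_mem size_word_nbrs.
by rewrite nth_index.
Qed.

Lemma word_adj_size u v : word_adj u v -> (size v <= (size u).+1)%N.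
Proof.
case/andP=> _ /orP[]/existsP[a /orP[]/eqP ->]; rewrite size_rcons //.
- by rewrite size_behead ltnS leq_pred.
- by rewrite ltnW.
- by rewrite size_behead; case: (size v).
Qed.

Lemma word_path_size u p : path word_adj u p -> (size (last u p) <= size u + size p)%N.
Proof.
elim: p u => [|v p IHp] u /=; first by rewrite addn0.
case/andP=> /word_adj_size uv /IHp /leq_trans-> //.
by rewrite addnS -addSn leq_add2r.
Qed.

(** Writing [t] at the end of [u] through a window of width [j]. Each letter costs
    at most one edge, and none when the window does not change, which happens
    when a letter [a] is written after [j] copies of [a]. *)
Lemma word_slide (j : nat) (t u : seq A) : (0 < j)%N -> (size u <= j)%N ->
  exists p, [/\ walk word_adj u (drop (size (u ++ t) - j) (u ++ t)) p,
    (size p <= size t)%N & all (fun v => size v <= j)%N p].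
Proof.
move=> j_gt0; elim: t u => [|a t IHt] u uj.
  exists [::]; split=> //; rewrite /walk /= cats0.
  by move: uj; rewrite -subn_eq0 => /eqP ->; rewrite drop0.
pose u' := if (size u < j)%N then rcons u a else rcons (behead u) a.
have u'j : (size u' <= j)%N.
  rewrite /u'; case: ifP => uj'; rewrite size_rcons ?size_behead //.
  by move: uj; case: (size u).
have uu' : append_or_shift u u'.
  by apply/existsP; exists a; rewrite /u'; case: ifP; rewrite eqxx ?orbT.
have end' : drop (size (u' ++ t) - j) (u' ++ t) =
            drop (size (u ++ a :: t) - j) (u ++ a :: t).
  rewrite /u'; case: ltnP => ju; first by rewrite cat_rcons.
  have {uj ju} uj : size u = j by apply/eqP; rewrite eqn_leq uj.
  case: u uj {u' u'j uu'} => [|b u] uj; first by rewrite -uj in j_gt0.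
  rewrite /= cat_rcons -uj size_cat /= subSS addKn /=.
  by rewrite addnS subSS addKn.
have [p [up pt pj]] := IHt u' u'j; rewrite end' in up.
have [uE|uNu'] := eqVneq u u'.
  by exists p; rewrite {1}uE; split=> //; rewrite (leq_trans pt) /=.
exists (u' :: p); split=> //=; last by rewrite u'j.
by rewrite /walk /= /word_adj uNu' uu'.
Qed.

(** Once all letters of [w] have been written, a window of width [size w] shows
    exactly [w]; [u] has to fit in it. The bound on the intermediate words keeps
    the walk in every ball around the root that contains [w]. *)
Lemma word_walk (u w : seq A) : (size u <= size w)%N ->
  exists p, [/\ walk word_adj u w p,
    (size p <= size w)%N & all (fun v => size v <= size w)%N p].
Proof.
case: (posnP (size w)) => [/size0nil ->|w_gt0 uw].
  rewrite leqn0 => /nilP ->; by exists [::]; rewrite /walk /=.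
by have := word_slide w w_gt0 uw; rewrite size_cat addnK drop_size_cat.
Qed.

Lemma word_connected : connected_graph word_adj.
Proof.
move=> u w; case: (leqP (size u) (size w)) => [|/ltnW] /word_walk[p [pw _ _]].
  by exists p.
by have [q] := rev_walk word_adj_sym pw; exists q.
Qed.

(** An edge lengthens a word by at most one letter, so [size u] edges are needed. *)
Lemma word_gdist_root u : gdist word_adj [::] u = size u.
Proof.
have [p [up pu _]] := @word_walk [::] u isT.
apply/eqP; rewrite eqn_leq (leq_trans (gdist_le up)) //=.
by apply: (gdist_ge up) => q /andP[/word_path_size + /eqP <-].
Qed.

Lemma in_word_ball (n : nat) (u : seq A) :
  (u \in gball ([::] : word_graph) n) = (size u <= n)%N.
Proof.
rewrite /gball in_fset_set; first by apply/idP/idP; rewrite inE /= word_gdist_root.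
apply: sub_finite_set (finite_bounded_seq A n) => v /=.
by rewrite word_gdist_root.
Qed.

(** The walk of [word_walk] goes from the shorter word to the longer one; the
    other direction follows by reversing it. *)
Lemma word_ball_diameter (n : nat) (x y : gball ([::] : word_graph) n) :
  (gdist (@induced_adj _ _) x y <= n)%N.
Proof.
have ind_sym : symmetric (@induced_adj word_graph (gball ([::] : word_graph) n)).
  by move=> u v; exact: word_adj_sym.
have walk_in (u w : gball ([::] : word_graph) n) : (size (val u) <= size (val w))%N ->
    exists2 q, walk (@induced_adj _ _) u w q & (size q <= n)%N.
  move=> /word_walk[p [/andP[up /eqP pw] sp pin]].
  have wn : (size (val w) <= n)%N by rewrite -in_word_ball; exact: fsvalP.
  have pE : map val (map (insubd u) p) = p.
    rewrite -map_comp map_id_in // => v /(allP pin) vw /=.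
    by rewrite insubdK // [_ \in _]in_word_ball (leq_trans vw).
  exists (map (insubd u) p); last by rewrite size_map (leq_trans sp).
  apply/andP; split; first exact: etrans (esym (path_map _ _)) (etrans (congr1 _ pE) up).
  by apply/eqP/val_inj; rewrite -[RHS]pw -[in RHS]pE last_map.
case: (leqP (size (val x)) (size (val y))) => [|/ltnW] /walk_in[q xyq qn].
  exact: leq_trans (gdist_le xyq) qn.
have [q' yxq q'E] := rev_walk ind_sym xyq.
by rewrite (leq_trans (gdist_le yxq)) // q'E.
Qed.

Lemma leq_card_word_ball (n : nat) :
  (#|A| ^ n <= #|` gball ([::] : word_graph) n|)%N.
Proof.
rewrite -card_tuple cardfE.
have tn (t : n.-tuple A) : (tval t : word_graph) \in gball ([::] : word_graph) n.
  by rewrite in_word_ball size_tuple.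
apply: (@leq_card _ _ (fun t => [` tn t]%fset)) => t1 t2 /(congr1 val) t12.
exact: val_inj.
Qed.

Lemma word_infinite : (0 < #|A|)%N -> infinite_set [set: word_graph].
Proof.
case/card_gt0P=> a _ fin; apply: infinite_nat.
apply: sub_finite_set (finite_image (size : seq A -> nat) fin) => n _.
by exists (nseq n a) => //; rewrite size_nseq.
Qed.

End Words.

(** * The exponent *)

(** The factors [n.+1 <= 2 ^ n] and [(3 * k).+2 <= 4 * k] cost [8 ^ n] in total,
    which the factor [(k ^ eps) ^ n] absorbs. *)
Lemma moves_count_le (R : realType) (eps : R) (k n : nat) : (2 <= k)%N ->
  8 <= k%:R `^ eps ->
  (n.+1 * (3 * k).+2 ^ n)%:R <= (k%:R ^+ n) `^ (1 + eps) :> R.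
Proof.
move=> k2 keps; apply: (@le_trans _ _ ((8 * k) ^ n)%:R).
  have -> : (8 * k = 2 * (4 * k))%N by rewrite mulnA.
  rewrite ler_nat expnMn leq_mul ?(ltn_expl n) //.
  have le4k : ((3 * k).+2 <= 4 * k)%N by rewrite (mulSnr 3) -addn2 leq_add2l.
  by case: n => // n; rewrite leq_exp2r.
have k_gt0 : 0 < k%:R :> R by rewrite ltr0n ltnW.
rewrite natrX natrM -(powR_mulrn n (ltW k_gt0)) -powRrM [n%:R * _]mulrC.
rewrite powRrM powR_mulrn ?powR_ge0 //.
rewrite lerXn2r ?nnegrE ?powR_ge0 ?mulr_ge0 ?ler0n //.
have k_neq0 : k%:R != 0 :> R by rewrite gt_eqF.
by rewrite powRD ?k_neq0 ?implybT // powRr1 ?ler0n // mulrC ler_pM2l.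
Qed.

Theorem mainTheorem3 (R : realType) (eps : R) (eps_gt0 : 0 < eps) :
  exists (G : graph) (x0 : G),
    [/\ connected_graph (@adj G),
        infinite_set [set: G],
        exponential_growth R x0,
        bounded_degree G
      & exists n1 : nat, forall n : nat, (n1 <= n)%N ->
          forall w : {set gball x0 n} -> seq (gball x0 n) -> R,
            geodesic_routing (@induced_adj G (gball x0 n)) w ->
          forall v : gball x0 n,
            traffic (@induced_adj G (gball x0 n)) w v
              <= #|` gball x0 n|%:R `^ (1 + eps)].
Proof.
pose k := (Num.truncn (8 `^ eps^-1 : R)).+2.
have keps : 8 <= k%:R `^ eps.
  have root8 : (8 `^ eps^-1) `^ eps = 8 :> R.
    by rewrite -powRrM mulVf ?gt_eqF // powRr1.
  rewrite -[leLHS]root8.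
  rewrite ge0_ler_powR ?nnegrE ?powR_ge0 ?ltW ?ler0n //.
  by rewrite (lt_trans (truncnS_gt _)) // ltr_nat.
have ball_ge n : k%:R ^+ n <= #|` gball ([::] : word_graph 'I_k) n|%:R :> R.
  by rewrite -natrX ler_nat -{1}[k]card_ord leq_card_word_ball.
exists (word_graph 'I_k), ([::] : word_graph 'I_k); split.
- exact: word_connected.
- by apply: word_infinite; rewrite card_ord.
- by exists 0, k%:R; split=> [|n _]; rewrite ?ltr1n.
- exact: word_bounded_degree.
exists 0 => n _ w rw v.
have ind_sym : symmetric (@induced_adj (word_graph 'I_k) (gball ([::] : word_graph 'I_k) n)).
  by move=> x y; exact: word_adj_sym.
apply: le_trans (traffic_le ind_sym (@word_degree _ _) v (@word_ball_diameter _ _) rw) _.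
rewrite card_ord (le_trans (moves_count_le _ _ keps)) //.
by rewrite ge0_ler_powR ?nnegrE ?exprn_ge0 ?ler0n // addr_ge0 // ltW.
Qed.
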